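(* For every agglomerate $T\in\mathcal{T}^H$ the local Schur complement $\Sigma_T=-[O,-X_T^T]\,\mathfrak{A}_T^{-1}\,[O,-X_T^T]^T$ is symmetric positive semidefinite; the global Schur complement $\Sigma=-[O,-X^T]\,\mathfrak{A}^{-1}\,[O,-X^T]^T$ is symmetric positive definite; and the global modified mortar matrix $\mathcal{A}$ is invertible.
   Context: **Mesh and original problem.** $\Omega\subset\mathbb{R}^d$ is a domain with Lipschitz boundary, $\mathcal{T}^h$ a triangulation of $\Omega$, and $\mathcal{U}^h\subset H^1_0(\Omega)$ the space of continuous piecewise polynomial finite element functions on $\mathcal{T}^h$ with the usual nodal degrees of freedom (dofs). Functions are identified with their coefficient vectors. $\kappa\in L^\infty(\Omega)$, $\kappa>0$, and $A$ is the symmetric positive definite (SPD) stiffness matrix of $a(u,v)=\int_\Omega\kappa\nabla u\cdot\nabla v$ on $\mathcal{U}^h$. $\mathcal{T}^H$ is a partition of $\mathcal{T}^h$ into non-overlapping connected sets $T$ of elements (agglomerates). $A_T$ is the symmetric positive semidefinite (SPSD) stiffness matrix of the same form restricted to $T$, on the dofs contained in $T$; $A=\sum_T A_T$ (with implicit local-to-global mapping); the null space of $A_T$ is either trivial or spanned by the constant vector, and at least one $A_T$ is nonsingular because of the essential boundary condition $u=0$ on $\partial\Omega$. $\Phi^H$ is the set of agglomerate faces: each $F\in\Phi^H$ is the $(d-1)$-dimensional interface, a union of fine faces, between two adjacent agglomerates $T_+,T_-\in\mathcal{T}^H$; then $F\subset\partial T_\pm$. **Nonconforming spaces.** $\mathcal{E}^h$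 consists of functions on $\Omega$ whose restriction to each $T\in\mathcal{T}^H$ is the restriction of some function in $\mathcal{U}^h$, with no continuity between different $T$; its degrees of freedom (edofs) are obtained by giving each $T$ its own copy of every dof contained in $T$. $\mathcal{F}^h$ consists of functions on $\bigcup_F F$ that on each $F\in\Phi^H$ are traces of functions in $\mathcal{U}^h$; its degrees of freedom (bdofs) are copies, one for each $F$, of the dofs contained in $F$. $\cdot|_T$ and $\cdot|_F$ denote the corresponding subvectors. Subspaces $\mathcal{E}^H\subset\mathcal{E}^h$ and $\mathcal{F}^H\subset\mathcal{F}^h$ are given by bases of linearly independent vectors $\{\mathbf q_{T,i}\}_{i=1}^{m_T}$ on the edofs of each $T$ and $\{\mathbf q_{F,i}\}_{i=1}^{m_F}$ on the bdofs of each $F$; $\mathcal{P}_T$, $\mathcal{P}_F$ are the matrices with these columns, and $\mathcal{P}_e=\operatorname{diag}(\mathcal{P}_T)_T$, $\mathcal{P}_b=\operatorname{diag}(\mathcal{P}_F)_F$ the prolongations. Elements of $\mathcal{E}^H,\mathcal{F}^H$ are identified with their coefficient vectors in these bases. $D_F$ is the restriction of the diagonal of $A$ to the bdofs of $F$. It is assumed that $\mathcal{F}^H$ contains the constants on each $F$ and that $\operatorname{span}\{\mathbf q_{F,i}\}$ is a proper subspace of the trace space on $F$ of $\mathcal{E}^H$. **Mortar matrices.** On $\mathcal{E}^H\times[\mathcal{F}^H]^2\times\mathcal{F}^H$, where $[\mathcal{F}^H]^2$ is the space of multipliers $\boldsymbol\mu=(\boldsymbol\mu_{T,F})_{T\in\mathcal{T}^H,F\subset\partial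 T}$, $\boldsymbol\mu_{T,F}\in\mathbb{R}^{m_F}$, let $$\mathcal{A}=\begin{bmatrix}\mathcal{A}_{ee}&C^T&\\ C&&-X\\ &-X^T&\end{bmatrix},\qquad \mathfrak{A}=\begin{bmatrix}\mathcal{A}_{ee}&C^T\\ C&\end{bmatrix},$$ with $\mathbf v^T\mathcal{A}_{ee}\mathbf u=\sum_T[(\mathcal{P}_e\mathbf v)|_T]^TA_T(\mathcal{P}_e\mathbf u)|_T$, $\boldsymbol\mu^TC\mathbf u=\sum_T\sum_{F\subset\partial T}(\mathcal{P}_F\boldsymbol\mu_{T,F})^TD_F((\mathcal{P}_e\mathbf u)|_T)|_F$, and $\boldsymbol\mu^TX\mathbf p=\sum_T\sum_{F\subset\partial T}(\mathcal{P}_F\boldsymbol\mu_{T,F})^TD_F(\mathcal{P}_b\mathbf p)|_F$. The local matrices on $T$ are obtained by keeping only the terms of the given $T$ and its unknowns: $\mathcal{A}_{T,ee}=\mathcal{P}_T^TA_T\mathcal{P}_T$, $C_T$ with row blocks indexed by $F\subset\partial T$, $X_T=\operatorname{diag}(\mathcal{P}_F^TD_F\mathcal{P}_F)_{F\subset\partial T}$, and $\mathfrak{A}_T=\begin{bmatrix}\mathcal{A}_{T,ee}&C_T^T\\ C_T&\end{bmatrix}$, so that $\mathfrak{A}=\operatorname{diag}(\mathfrak{A}_T)_T$, and $\Sigma$ is assembled from the $\Sigma_T$. The formulation is assumed not over-constrained, i.e. each $C_T^T$ has full column rank; then all $\mathfrak{A}_T$ and $\mathfrak{A}$ are invertible.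 *)

(* Defs.v *)
From HB Require Import structures.
From mathcomp Require Import all_boot all_order all_algebra.
From mathcomp Require Import all_classical all_reals all_analysis.

Set Implicit Arguments.
Unset Strict Implicit.
Unset Printing Implicit Defensive.

Import Order.TTheory GRing.Theory Num.Theory.
Import numFieldNormedType.Exports.

Local Open Scope classical_set_scope.
Local Open Scope ring_scope.

(* Vectors and matrices with rows/columns indexed by a finite type I are
   numbered by #|I| through [enum_val]. *)
Definition mx_of (R : Type) (I J : finType) (f : I -> J -> R) :
  'M[R]_(#|I|, #|J|) := \matrix_(i, j) f (enum_val i) (enum_val j).

(* [subv h *m x] is the subvector of x with entries indexed by h i, i < n. *)
Definition subv (R : nzRingType) (n : nat) (J : finType) (h : 'I_n -> J) :
  'M[R]_(n, #|J|) := \matrix_(i, j) (enum_val j == h i)%:R.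

Definition spsd (R : realType) (n : nat) (M : 'M[R]_n) : Prop :=
  M^T = M /\ forall x : 'cV[R]_n, 0 <= (x^T *m M *m x) 0 0.

Definition spd (R : realType) (n : nat) (M : 'M[R]_n) : Prop :=
  M^T = M /\ forall x : 'cV[R]_n, x != 0 -> 0 < (x^T *m M *m x) 0 0.

Notation borel R d' := (g_sigma_algebraType (@open 'rV[R]_d'.+1)).

Section Geometry.
Variables (R : realType) (d' : nat).
Local Notation d := d'.+1.
Local Notation point := 'rV[R]_d.

(* Near each boundary point, in coordinates rotated by Q, Om is the strict
   epigraph of a Lipschitz function of the last d - 1 coordinates. *)
Definition lipschitz_boundary (Om : set point) : Prop :=
  forall x, (closure Om `\` Om^°) x ->
  exists (Q : 'M[R]_d) (r L : R) (g : 'rV[R]_d' -> R),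
    [/\ Q *m Q^T = 1%:M, 0 < r,
        forall y z, `|g y - g z| <= L * `|y - z|
      & forall y : point, `|y| < r ->
          Om (x + y *m Q) <-> g (col' ord0 y) < y 0 ord0].

Definition lipschitz_domain (Om : set point) : Prop :=
  [/\ open Om, connected Om, Om !=set0, bounded_set Om & lipschitz_boundary Om].

Definition affine_indep (V : finType) (pos : V -> point) (S : {set V}) : Prop :=
  forall c : V -> R, \sum_(v in S) c v = 0 -> \sum_(v in S) c v *: pos v = 0 ->
  forall v, v \in S -> c v = 0.

Definition conv_hull (V : finType) (pos : V -> point) (S : {set V}) :
  set point :=
  [set x | exists c : V -> R, [/\ forall v, 0 <= c v, \sum_(v in S) c v = 1
                                & x = \sum_(v in S) c v *: pos v]].

Record triangulation_of (Om : set point) (V E : finType) (pos : V -> point)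
    (vert : E -> {set V}) : Prop := Triangulation {
  vert_inj : injective vert;
  vert_card : forall K, #|vert K| = d.+1;
  vert_indep : forall K, affine_indep pos (vert K);
  mesh_conforming : forall K K',
    conv_hull pos (vert K) `&` conv_hull pos (vert K') =
    conv_hull pos (vert K :&: vert K');
  mesh_cover : \bigcup_K conv_hull pos (vert K) = closure Om }.

(* The nodes of the Lagrange element of degree k on the simplex S. *)
Definition lagrange_node (V : finType) (pos : V -> point) (k : nat)
    (S : {set V}) : set point :=
  [set x | exists al : V -> nat, (\sum_(v in S) al v = k)%N /\
     x = \sum_(v in S) ((al v)%:R / k%:R) *: pos v].

Definition polynomial_on (k : nat) (D : set point) (u : point -> R) : Prop :=
  exists c : {ffun 'I_d -> 'I_k.+1} -> R, forall x, D x ->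
    u x = \sum_(al : {ffun 'I_d -> 'I_k.+1} | (\sum_j (al j : nat) <= k)%N)
            c al * \prod_j x 0 j ^+ al j.

(* Continuous piecewise polynomials of degree at most k vanishing on the
   boundary of Om, extended by zero outside Om. *)
Definition fe_space (Om : set point) (V E : finType) (pos : V -> point)
    (vert : E -> {set V}) (k : nat) : set (point -> R) :=
  [set u | [/\ continuous u, forall x, ~ Om x -> u x = 0
    & forall K, polynomial_on k (conv_hull pos (vert K)) u]].

(* Lebesgue measure is the only Borel measure with these values on boxes. *)
Definition is_lebesgue (mu : set (borel R d') -> \bar R) : Prop :=
  forall a b : point, (forall j, a 0 j <= b 0 j) ->
  mu [set x : point | forall j, a 0 j <= x 0 j < b 0 j] =
  (\prod_j (b 0 j - a 0 j))%:E.

Definition energy (mu : {measure set (borel R d') -> \bar R}) (kappa : point -> R)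
    (D : set point) (u v : point -> R) : R :=
  Rintegral mu D (fun x => kappa x *
    \sum_(l < d) 'D_(delta_mx 0 l : point) u x * 'D_(delta_mx 0 l : point) v x).

End Geometry.

Record fe_problem (R : realType) (d' : nat) := FEProblem {
  Om : set 'rV[R]_d'.+1;
  Om_domain : lipschitz_domain Om;
  vtx : finType;
  elt : finType;
  pos : vtx -> 'rV[R]_d'.+1;
  vert : elt -> {set vtx};
  meshP : triangulation_of Om pos vert;
  deg : nat;
  deg_gt0 : (0 < deg)%N;
  dof : finType;
  node : dof -> 'rV[R]_d'.+1;
  node_inj : injective node;
  nodeP : range node =
    (\bigcup_K lagrange_node pos deg (vert K)) `&` Om;
  shape : dof -> 'rV[R]_d'.+1 -> R;
  shape_fe : forall i, fe_space Om pos vert deg (shape i);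
  shape_node : forall i j, shape i (node j) = (i == j)%:R;
  mu : {measure set (borel R d') -> \bar R};
  muP : is_lebesgue mu;
  kappa : borel R d' -> R;
  kappa_meas : measurable_fun (Om : set (borel R d')) kappa;
  kappa_bound : exists M : R, {ae mu, forall x, Om x -> `|kappa x| <= M};
  kappa_gt0 : {ae mu, forall x, Om x -> 0 < kappa x};
  (* the agglomerates are the fibres of agg *)
  aggl : finType;
  agg : elt -> aggl;
  agg_surj : forall T, exists K, agg K = T;
  agg_connected : forall T,
    connected (\bigcup_(K in [set K | agg K = T]) conv_hull pos (vert K)) }.

Section Fine.
Variables (R : realType) (d' : nat) (P : fe_problem R d').
Local Notation d := d'.+1.

Definition region (T : aggl P) : set 'rV[R]_d :=
  \bigcup_(K in [set K | agg K = T]) conv_hull (@pos _ _ P) (vert K).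

Definition fine_face_between (F : {set aggl P}) (K K' : elt P) : bool :=
  [&& agg K \in F, agg K' \in F, agg K != agg K'
    & #|vert K :&: vert K'| == d].

(* An agglomerate face is identified with the pair {T+, T-} of agglomerates
   which it separates; F \subset \partial T reads T \in val F. *)
Definition is_face (F : {set aggl P}) : bool :=
  (#|F| == 2%N) && [exists K, exists K', fine_face_between F K K'].

Definition face : finType := {F : {set aggl P} | is_face F}.

Definition face_region (F : face) : set 'rV[R]_d :=
  [set x | exists K K', fine_face_between (val F) K K' /\
     conv_hull (@pos _ _ P) (vert K :&: vert K') x].

Definition bface (T : aggl P) : finType := {F : face | T \in val F}.

Definition edof (T : aggl P) : finType :=
  {i : dof P | `[< region T (node i) >]}.

Definition bdof (F : face) : finType :=
  {i : dof P | `[< face_region F (node i) >]}.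

Definition stiff : 'M[R]_#|dof P| :=
  mx_of (fun i j : dof P =>
    energy (mu P) (@kappa _ _ P) (Om P) (shape i) (shape j)).

Definition stiff_loc (T : aggl P) : 'M[R]_#|edof T| :=
  mx_of (fun i j : edof T =>
    energy (mu P) (@kappa _ _ P) (region T) (shape (val i)) (shape (val j))).

Definition Dmx (F : face) : 'M[R]_#|bdof F| :=
  mx_of (fun b b' : bdof F =>
    stiff (enum_rank (val b)) (enum_rank (val b)) *+ (b == b')).

(* v |-> v|_F for a vector v on the edofs of T, when T \in val F. *)
Definition face_trace (T : aggl P) (F : face) :
  'M[R]_(#|bdof F|, #|edof T|) :=
  mx_of (fun (b : bdof F) (e : edof T) => (val b == val e)%:R).

End Fine.

Record coarse_spaces (R : realType) (d' : nat) (P : fe_problem R d') :=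
  CoarseSpaces {
    mT : aggl P -> nat;
    PT : forall T, 'M[R]_(#|edof T|, mT T);
    PT_free : forall T, row_free (PT T)^T;
    mF : face P -> nat;
    PF : forall F, 'M[R]_(#|bdof F|, mF F);
    PF_free : forall F, row_free (PF F)^T }.

Section Mortar.
Variables (R : realType) (d' : nat) (P : fe_problem R d').
Variable W : coarse_spaces P.

Definition contains_constants (F : face P) : Prop :=
  ((const_mx 1 : 'rV[R]_#|bdof F|) <= (PF W F)^T)%MS.

(* The traces on F of functions of E^H are taken from both sides of F. *)
Definition proper_in_trace_space (F : face P) : Prop :=
  ((PF W F)^T < \sum_(T in val F) <<(face_trace T F *m PT W T)^T>>)%MS.

(* Index types of the edofs and bdofs, and of the coefficients of elements of
   E^H, F^H, [F^H]^2 restricted to T, F^H restricted to T (same index type) and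
   [F^H]^2. *)
Definition edofs : finType := {T : aggl P & edof T}.
Definition bdofs : finType := {F : face P & bdof F}.
Definition ecoef : finType := {T : aggl P & 'I_(mT W T)}.
Definition bcoef : finType := {F : face P & 'I_(mF W F)}.
Definition mult (T : aggl P) : finType :=
  {F : bface T & 'I_(mF W (val F))}.
Definition mults : finType := {T : aggl P & mult T}.

Definition to_edofs (T : aggl P) : 'M[R]_(#|edof T|, #|edofs|) :=
  subv R (fun i => Tagged (fun T => edof T) (enum_val i)).
Definition to_bdofs (F : face P) : 'M[R]_(#|bdof F|, #|bdofs|) :=
  subv R (fun i => Tagged (fun F => bdof F) (enum_val i)).
Definition to_ecoef (T : aggl P) : 'M[R]_(mT W T, #|ecoef|) :=
  subv R (fun i => Tagged (fun T => 'I_(mT W T)) i).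
Definition to_bcoef (F : face P) : 'M[R]_(mF W F, #|bcoef|) :=
  subv R (fun i => Tagged (fun F => 'I_(mF W F)) i).
Definition to_mult (T : aggl P) (F : bface T) :
  'M[R]_(mF W (val F), #|mult T|) :=
  subv R (fun i => Tagged (fun F : bface T => 'I_(mF W (val F))) i).
Definition to_mults (T : aggl P) (F : bface T) :
  'M[R]_(mF W (val F), #|mults|) :=
  subv R (fun i => Tagged mult
    (Tagged (fun F : bface T => 'I_(mF W (val F))) i)).

Definition Pe : 'M[R]_(#|edofs|, #|ecoef|) :=
  \sum_T (to_edofs T)^T *m PT W T *m to_ecoef T.
Definition Pb : 'M[R]_(#|bdofs|, #|bcoef|) :=
  \sum_F (to_bdofs F)^T *m PF W F *m to_bcoef F.

Definition Aee : 'M[R]_#|ecoef| :=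
  \sum_T (to_edofs T *m Pe)^T *m stiff_loc T *m (to_edofs T *m Pe).

Definition Cmx : 'M[R]_(#|mults|, #|ecoef|) :=
  \sum_T \sum_(F : bface T)
    (PF W (val F) *m to_mults F)^T *m Dmx (val F)
    *m (face_trace T (val F) *m (to_edofs T *m Pe)).

Definition Xmx : 'M[R]_(#|mults|, #|bcoef|) :=
  \sum_T \sum_(F : bface T)
    (PF W (val F) *m to_mults F)^T *m Dmx (val F) *m (to_bdofs (val F) *m Pb).

Definition frakA : 'M[R]_(#|ecoef| + #|mults|) := block_mx Aee Cmx^T Cmx 0.

Definition calA : 'M[R]_((#|ecoef| + #|mults|) + #|bcoef|) :=
  block_mx frakA (col_mx 0 (- Xmx)) (row_mx 0 (- Xmx^T)) 0.

Definition Sigma : 'M[R]_#|bcoef| :=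
  - (row_mx (0 : 'M[R]_(#|bcoef|, #|ecoef|)) (- Xmx^T) *m invmx frakA
     *m (row_mx (0 : 'M[R]_(#|bcoef|, #|ecoef|)) (- Xmx^T))^T).

Section Local.
Variable T : aggl P.

Definition Aee_loc : 'M[R]_(mT W T) := (PT W T)^T *m stiff_loc T *m PT W T.

Definition C_loc : 'M[R]_(#|mult T|, mT W T) :=
  \sum_(F : bface T)
    (PF W (val F) *m to_mult F)^T *m Dmx (val F)
    *m (face_trace T (val F) *m PT W T).

Definition X_loc : 'M[R]_#|mult T| :=
  \sum_(F : bface T)
    (to_mult F)^T *m ((PF W (val F))^T *m Dmx (val F) *m PF W (val F))
    *m to_mult F.

Definition frakA_loc : 'M[R]_(mT W T + #|mult T|) :=
  block_mx Aee_loc C_loc^T C_loc 0.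

Definition Sigma_loc : 'M[R]_#|mult T| :=
  - (row_mx (0 : 'M[R]_(#|mult T|, mT W T)) (- X_loc^T) *m invmx frakA_loc
     *m (row_mx (0 : 'M[R]_(#|mult T|, mT W T)) (- X_loc^T))^T).

End Local.

End Mortar.

(* Main.v *)
Require Import Defs.
From mathcomp Require Import all_boot all_order all_algebra.
From mathcomp Require Import all_classical all_reals all_analysis.
From mathcomp Require Import ring lra.

(* Eliminating u and lambda from A_ee u + C^T lambda = 0, C u = - X p gives
   p^T Sigma p = u^T A_ee u, so Sigma inherits semidefiniteness from A_ee, and
   everything reduces to showing that A_ee u = 0 and C u = X p force u = 0 and
   p = 0.  From A_ee u = 0 each P_T u_T is a constant c_T.  On every face F of T
   the constants lie in the range of P_F and D_F is positive, so C u = X p says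
   that P_F p_F is the constant c_T; hence the two sides of F carry the same
   constant.  The face graph of the agglomerates is connected and c_T = 0 where
   A_T is nonsingular, so all c_T vanish.

   The connectedness of the face graph is where the geometry of the mesh enters.
   If no face joined two complementary families of agglomerates, their unions
   A and B would be closed sets covering the connected open set Omega and
   meeting only in simplices of codimension at least two.  Such a set does not
   disconnect a ball: a segment in general position from A to B misses it. *)

Set Implicit Arguments.
Unset Strict Implicit.
Unset Printing Implicit Defensive.

Import Order.TTheory GRing.Theory Num.Theory.
Import numFieldNormedType.Exports.
Local Open Scope classical_set_scope.
Local Open Scope ring_scope.

(** * Affine sets and simplices *)

Section AffineSets.
Variables (R : realType) (n : nat).
Implicit Types (x y a b : 'rV[R]_n.+1).

(* A column f acts on homog x = (1, x) as an affine functional of x, whose zero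
   set is a hyperplane (or empty) when f is nonzero. *)
Definition homog x : 'rV[R]_(1 + n.+1) := row_mx 1%:M x.

Lemma homogE x (f : 'cV[R]_(1 + n.+1)) :
  (homog x *m f) 0 0 = f 0 0 + \sum_j x 0 j * f (rshift 1 j) 0.
Proof.
rewrite mxE big_split_ord /= big_ord1 row_mxEl mxE eqxx mul1r.
congr (f _ _ + _); first exact/val_inj.
by apply: eq_bigr => j _; rewrite row_mxEr.
Qed.

Lemma homog_comb (I : finType) (P : pred I) (c : I -> R) (p : I -> 'rV[R]_n.+1) :
  \sum_(i | P i) c i = 1 ->
  homog (\sum_(i | P i) c i *: p i) = \sum_(i | P i) c i *: homog (p i).
Proof.
move=> c1; apply/rowP => j; rewrite summxE.
under [RHS]eq_bigr do rewrite mxE.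
case: (split_ordP j) => k ->.
  rewrite row_mxEl ord1 mxE eqxx -c1; apply: eq_bigr => i _.
  by rewrite row_mxEl mxE eqxx mulr1.
rewrite row_mxEr summxE; apply: eq_bigr => i _.
by rewrite row_mxEr mxE.
Qed.

Lemma homog_continuous (f : 'cV[R]_(1 + n.+1)) :
  continuous (fun x => (homog x *m f) 0 0).
Proof.
under eq_fun do rewrite homogE.
move=> x; apply: continuousD; first exact: cst_continuous.
apply: continuous_big => [|j _ y]; first exact: add_continuous.
by apply: continuousM; [exact: coord_continuous|exact: cst_continuous].
Qed.

(** The points [r / (i + 2)] with [i < size q] all lie in the interval and outnumber the roots of
    [q]. *)
Lemma nonroot_itv (q : {poly R}) (r : R) : q != 0 -> 0 < r ->
  exists t, [/\ 0 < t, t < r & q.[t] != 0].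
Proof.
move=> q0 r0; apply: contrapT => no.
pose rs := [seq r / (i.+2)%:R | i <- iota 0 (size q)].
have : (size rs < size q)%N.
  apply: max_poly_roots => //.
    apply/allP => _ /mapP[i _ ->]; apply/negPn/negP => qt.
    apply: no; exists (r / i.+2%:R); split=> //; first by rewrite divr_gt0.
    by rewrite ltr_pdivrMr // ltr_pMr // ltr1n.
  rewrite map_inj_uniq ?iota_uniq // => i j /(mulfI (lt0r_neq0 r0)).
  by move=> /invr_inj/eqP; rewrite eqr_nat => /eqP[].
by rewrite size_map size_iota ltnn.
Qed.

(* The witness is a point of the moment curve through a: along it each functional
   is a nonzero polynomial in the parameter. *)
Lemma ball_avoids_hyperplanes (I : finType) (f : I -> 'cV[R]_(1 + n.+1)) a (r : R) :
  0 < r -> (forall i, f i != 0) ->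
  exists2 x, ball a r x & forall i, (homog x *m f i) 0 0 != 0.
Proof.
move=> r0 f0.
pose q i : {poly R} := ((homog a *m f i) 0 0)%:P +
  \sum_(j < n.+1) f i (rshift 1 j) 0 *: 'X^(j.+1).
pose x t := a + \row_j t ^+ j.+1.
have xE i t : (homog (x t) *m f i) 0 0 = (q i).[t].
  rewrite /q hornerD hornerC horner_sum !homogE -addrA; congr (_ + _).
  rewrite -big_split /=; apply: eq_bigr => j _.
  by rewrite !mxE hornerZ hornerXn mulrDl [X in _ + X]mulrC.
have q0 i : q i != 0.
  apply: contra_neq (f0 i) => qi0.
  have qc k : (q i)`_k = 0 by rewrite qi0 coef0.
  have fj (j : 'I_n.+1) : f i (rshift 1 j) 0 = 0.
    have := qc j.+1; rewrite coefD coefC /= add0r coef_sum (bigD1 j) //=.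
    rewrite coefZ coefXn eqxx mulr1 big1 ?addr0 // => k kj.
    by rewrite coefZ coefXn eqSS (inj_eq val_inj) eq_sym (negPf kj) mulr0.
  have f00 : f i 0 0 = 0.
    have := qc 0; rewrite coefD coefC eqxx coef_sum big1 => [|k _].
      rewrite addr0 homogE big1 ?addr0 // => k _; by rewrite fj mulr0.
    by rewrite coefZ coefXn mulr0.
  apply/colP => k; rewrite [RHS]mxE; case: (split_ordP k) => l ->; last exact: fj.
  by rewrite -[RHS]f00 ord1; congr (f i _ 0); exact: val_inj.
(* With [t < 1] every power [t ^+ j.+1] is at most [t < r], so [x t] stays in the ball, which is
   measured entrywise. *)
have r1 : 0 < Num.min r 1 by rewrite lt_min r0 ltr01.
have [|t [t0]] := @nonroot_itv (\prod_i q i) _ _ r1.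
  by apply/prodf_neq0 => i _.
rewrite lt_min => /andP[tr t1]; rewrite horner_prod => /prodf_neq0 qt.
exists (x t); last by move=> i; rewrite xE qt.
split=> // i j; rewrite /ball /= !mxE opprD addNKr normrN.
rewrite ger0_norm ?exprn_ge0 ?(ltW t0) //.
rewrite exprS (le_lt_trans _ tr) // ger_pMr //.
by rewrite exprn_ile1 ?ltW.
Qed.

(** If the segment avoided the intersection of [A] and [B], the parameters landing in [A] would form
    a nonempty relatively clopen part of [[0, 1]], hence all of it, and [b] would lie in both
    sets. *)
Lemma closed_segment_cover (A B : set 'rV[R]_n.+1) a b :
  closed A -> closed B -> A a -> B b ->
  (forall t : R, 0 <= t <= 1 -> (A `|` B) ((1 - t) *: a + t *: b)) ->
  exists2 t : R, 0 <= t <= 1 & (A `&` B) ((1 - t) *: a + t *: b).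
Proof.
move=> cA cB Aa Bb AB; apply: contrapT => no.
pose g (t : R) := (1 - t) *: a + t *: b.
have gc : continuous g.
  move=> t; apply: cvgD; (apply: cvgZ; last exact: cvg_cst).
    by apply: cvgB; [exact: cvg_cst|exact: cvg_id].
  exact: cvg_id.
have /= gA : `[0, 1]%classic `&` (g @^-1` A) = `[0, 1]%classic.
  apply: (@segment_connected R 0 1).
  - exists 0; split; first by rewrite /= in_itv /= lexx ler01.
    by rewrite /g /= subr0 scale1r scale0r addr0.
  - exists (g @^-1` (~` B)).
      by apply: open_comp => [t _|]; [exact: gc|exact: closed_openC].
    apply/seteqP; split=> t /= [t01 gt]; split=> //;
      move: (t01); rewrite in_itv /= => t01'.
      by move=> Bt; apply: no; exists t.
    by case: (AB t t01').
  - exists (g @^-1` A) => //.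
    by apply: preimage_closed => // t _; exact: gc.
have : (`[0, 1]%classic `&` (g @^-1` A)) 1 by rewrite gA /= in_itv /= lexx ler01.
case=> _; rewrite /g /= subrr scale0r add0r scale1r => Ab.
apply: no; exists 1; first by rewrite lexx ler01.
by rewrite subrr scale0r add0r scale1r.
Qed.

Variable (V : finType).
Implicit Types (pos : V -> 'rV[R]_n.+1) (S : {set V}).

Lemma conv_hull_homog pos S x :
  conv_hull pos S x -> (homog x <= \sum_(v in S) <<homog (pos v)>>)%MS.
Proof.
case=> c [_ c1 ->]; rewrite homog_comb //; apply: summx_sub => v vS.
by apply/scalemx_sub/(sumsmx_sup v) => //; rewrite genmxE.
Qed.

Lemma rank_homog_sum pos S : (\rank (\sum_(v in S) <<homog (pos v)>>)%MS <= #|S|)%N.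
Proof.
rewrite -sum1_card.
apply: (big_ind2 (fun (A : 'M[R]_(1 + n.+1)) k => (\rank A <= k)%N)).
- by rewrite mxrank0.
- move=> A1 k1 A2 k2 h1 h2.
  exact: leq_trans (mxrank_adds_leqif _ _) (leq_add h1 h2).
- by move=> v _; rewrite genmxE rank_leq_row.
Qed.

(** The vertices and [b] give at most [n + 1] vectors in a space of dimension [n + 2], so a nonzero
    column of the cokernel annihilates them all. *)
Lemma conv_hull_hyperplane pos S b : (#|S| <= n)%N ->
  exists2 f : 'cV[R]_(1 + n.+1), f != 0 &
    (homog b *m f) 0 0 = 0 /\
    forall x, conv_hull pos S x -> (homog x *m f) 0 0 = 0.
Proof.
move=> Sn; pose A := ((\sum_(v in S) <<homog (pos v)>>) + <<homog b>>)%MS.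
have rA : (\rank A < 1 + n.+1)%N.
  apply: leq_ltn_trans (mxrank_adds_leqif _ _) _.
  rewrite genmxE -addn1 addnC leq_add //.
  apply: leq_trans (leq_add (rank_homog_sum _ _) (rank_leq_row _)) _.
  by rewrite addn1.
have : cokermx A != 0.
  by rewrite -mxrank_eq0 mxrank_coker subn_eq0 -ltnNge.
move=> /matrix0Pn[i [j Aij]].
have fE x : (homog x <= A)%MS -> (homog x *m col j (cokermx A)) 0 0 = 0.
  rewrite submxE => /eqP xA.
  by rewrite colE mulmxA xA mul0mx mxE.
exists (col j (cokermx A)).
  by apply/matrix0Pn; exists i, 0; rewrite mxE.
split; first by apply: fE; rewrite (submx_trans _ (addsmxSr _ _)) // genmxE.
by move=> x /conv_hull_homog xS; apply: fE; rewrite (submx_trans xS) // addsmxSl.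
Qed.

(** The leading entry [s] is left free: [s = 1] gives barycentric combinations, [s = 0] affine
    dependences. *)
Lemma homog_combP pos S (c : V -> R) (s : R) x :
  row_mx s%:M x = \sum_(v in S) c v *: homog (pos v) ->
  \sum_(v in S) c v = s /\ x = \sum_(v in S) c v *: pos v.
Proof.
move=> /rowP xc; split.
  have := xc (lshift _ 0); rewrite row_mxEl mxE eqxx mulr1n summxE => ->.
  by apply: eq_bigr => v _; rewrite mxE row_mxEl mxE eqxx mulr1.
apply/rowP => j; have := xc (rshift 1 j); rewrite row_mxEr summxE => ->.
by rewrite summxE; apply: eq_bigr => v _; rewrite mxE [RHS]mxE row_mxEr.
Qed.

Lemma affine_indep_inj pos S (c c' : V -> R) : affine_indep pos S ->
  \sum_(v in S) c v = \sum_(v in S) c' v ->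
  \sum_(v in S) c v *: pos v = \sum_(v in S) c' v *: pos v ->
  forall v, v \in S -> c v = c' v.
Proof.
move=> indep e1 e2 v vS; apply/eqP; rewrite -subr_eq0; apply/eqP.
apply: (indep (fun v => c v - c' v)) => //.
  by rewrite sumrB e1 subrr.
by under eq_bigr do rewrite scalerBl; rewrite sumrB e2 subrr.
Qed.

(** The [n + 2] homogenized vertices form a basis; the functionals are the columns of the inverse of
    the matrix having them as rows. *)
Lemma barycentric_coord pos S : affine_indep pos S -> #|S| = n.+2 ->
  exists f : V -> 'cV[R]_(1 + n.+1), forall x,
    homog x = \sum_(v in S) (homog x *m f v) 0 0 *: homog (pos v).
Proof.
move=> indep Sn.
pose M : 'M[R]_(#|S|, 1 + n.+1) := \matrix_i homog (pos (enum_val i)).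
have [v0 v0S] : exists v, v \in S by apply/card_gt0P; rewrite Sn.
have Mfree : row_free M.
  apply: inj_row_free => u uM.
  have : row_mx 0%:M 0 = \sum_(v in S) u 0 (enum_rank_in v0S v) *: homog (pos v).
    rewrite [RHS]big_enum_val raddf0 row_mx0 -[LHS]uM mulmx_sum_row.
    by apply: eq_bigr => i _; rewrite rowK enum_valK_in.
  move=> /homog_combP[u0 u1]; apply/rowP => i; rewrite mxE -(enum_valK_in v0S i).
  exact: (indep (fun v => u 0 (enum_rank_in v0S v))) (enum_valP i).
have Mfull : row_full M by rewrite -col_leq_rank (eqP Mfree) Sn.
exists (fun v => col (enum_rank_in v0S v) (pinvmx M)) => x.
rewrite -[LHS](mulmxKpV (submx_full (homog x) Mfull)) mulmx_sum_row [RHS]big_enum_val.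
apply: eq_bigr => i _; rewrite rowK enum_valK_in; congr (_ *: _).
by rewrite [LHS]mxE [RHS]mxE; apply: eq_bigr => j _; congr (_ * _); rewrite [RHS]mxE.
Qed.

Lemma conv_hull_barycentric pos S : affine_indep pos S -> #|S| = n.+2 ->
  exists f : V -> 'cV[R]_(1 + n.+1),
    conv_hull pos S = [set x | forall v, v \in S -> 0 <= (homog x *m f v) 0 0].
Proof.
move=> indep Sn; have [f fE] := barycentric_coord indep Sn; exists f.
apply/seteqP; split=> x /= => [[c [c0 c1 xE]] v vS|fx0].
  have [f1 xf] := homog_combP (fE x).
  rewrite -(affine_indep_inj (c := c) (c' := fun v => (homog x *m f v) 0 0) indep) //.
    by rewrite c1 f1.
  by rewrite -xE.
have [f1 xf] := homog_combP (fE x).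
(* [conv_hull] asks for nonnegative weights on all of [V], so the coordinates are cut to zero
   outside [S]. *)
exists (fun v => if v \in S then (homog x *m f v) 0 0 else 0); split.
- by move=> v; case: ifP => // /fx0.
- by rewrite -[RHS]f1; apply: eq_bigr => v ->.
- by rewrite [LHS]xf; apply: eq_bigr => v ->.
Qed.

Lemma closed_simplex pos S : affine_indep pos S -> #|S| = n.+2 ->
  closed (conv_hull pos S).
Proof.
move=> indep Sn; have [f ->] := conv_hull_barycentric indep Sn.
rewrite (_ : mkset _ = \bigcap_(v in [set v | v \in S])
  [set x | 0 <= (homog x *m f v) 0 0]) //.
apply: closed_bigI => v _.
apply: (@preimage_closed _ _ (fun x => (homog x *m f v) 0 0) [set t | 0 <= t]).
  by move=> x _; exact: homog_continuous.
exact: closed_ge.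
Qed.

Definition barycenter pos S := \sum_(v in S) #|S|%:R^-1 *: pos v.

Lemma barycenter_weights S : (0 < #|S|)%N ->
  \sum_(v in S) (#|S|%:R^-1 : R) = 1.
Proof.
by move=> S0; rewrite sumr_const -[_ *+ _]mulr_natl divff // pnatr_eq0 -lt0n.
Qed.

Lemma conv_hull_barycenter pos S : (0 < #|S|)%N ->
  conv_hull pos S (barycenter pos S).
Proof.
move=> S0; exists (fun=> #|S|%:R^-1); split=> //.
exact: barycenter_weights.
Qed.

(** Barycentric coordinates with respect to [S] are unique. Those of the barycenter are all nonzero,
    while a point of the face [S'] has zero coordinates outside [S']. *)
Lemma barycenter_subface pos S S' : affine_indep pos S -> (0 < #|S|)%N ->
  S' \subset S -> conv_hull pos S' (barycenter pos S) -> S \subset S'.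
Proof.
move=> indep S0 S'S [c [_ c1 bE]]; apply/fintype.subsetP => v vS.
pose c' v := if v \in S' then c v else 0.
have S'E (W : nmodType) (F : V -> W) :
  \sum_(v in S) (if v \in S' then F v else 0) = \sum_(v in S') F v.
  rewrite -big_mkcondr; apply: eq_bigl => w.
  by rewrite andbC andb_idr // => /(fintype.subsetP S'S).
have : #|S|%:R^-1 = c' v.
  apply: (affine_indep_inj indep (c := fun=> _)) => //.
    by rewrite S'E barycenter_weights.
  rewrite -[LHS]/(barycenter pos S) bE -S'E; apply: eq_bigr => w _.
  by rewrite /c'; case: ifP => // _; rewrite scale0r.
rewrite /c'; case: ifP => // _ /eqP.
by rewrite invr_eq0 pnatr_eq0 eqn0Ngt S0.
Qed.

(** * Sets of codimension at least two do not separate open connected sets *)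

Section Separation.
Variables (pos : V -> 'rV[R]_n.+1) (I : finType) (S : I -> {set V}).
Variables A B : set 'rV[R]_n.+1.
Hypotheses (cA : closed A) (cB : closed B).
Hypothesis S_small : forall i, (#|S i| <= n)%N.
Hypothesis AB_small : A `&` B `<=` \bigcup_i conv_hull pos (S i).

Lemma ball_shrink x (r : R) a : ball x r a -> ~ B a ->
  exists2 e : R, 0 < e & ball a e `<=` ball x r `&` ~` B.
Proof.
move=> xa Ba.
have : nbhs a (ball x r `&` ~` B).
  apply: filterI.
    by apply: open_nbhs_nbhs; split=> //; exact: ball_open.
  by apply: open_nbhs_nbhs; split=> //; exact: closed_openC.
by move=> /nbhs_ballP[e e0 ?]; exists e.
Qed.

Lemma ball_segment x (r : R) a b (t : R) : 0 <= t <= 1 ->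
  ball x r a -> ball x r b -> ball x r ((1 - t) *: a + t *: b).
Proof.
move=> /andP[t0 t1]; rewrite -ball_normE /ball_ /= => xa xb.
have -> : x - ((1 - t) *: a + t *: b) = (1 - t) *: (x - a) + t *: (x - b).
  by rewrite !scalerBr opprD addrACA -scalerDl subrK scale1r.
apply: le_lt_trans (ler_normD _ _) _.
rewrite !normrZ (ger0_norm t0) ger0_norm ?subr_ge0 //.
have [->|t'] := eqVneq t 0; first by rewrite subr0 mul1r mul0r addr0.
have : 0 < t * (r - `|x - b|) by rewrite mulr_gt0 ?subr_gt0 // lt0r t'.
have : 0 <= (1 - t) * (r - `|x - a|) by rewrite mulr_ge0 ?subr_ge0 // ltW.
lra.
Qed.

(** Take [b] outside [A] and [a0] outside [B], and hyperplanes through [b] containing the hulls of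
    the [S i]. Move [a0] to a nearby [a] off all of them. The segment from [a] to [b] meets both
    sets at a common point on one of these hyperplanes, which it can cross only at [b]; but [b] is
    not in [A]. *)
Lemma ball_one_side x (r : R) : ball x r `<=` A `|` B ->
  ball x r `<=` A \/ ball x r `<=` B.
Proof.
move=> UAB; apply: contrapT => /not_orP[/existsNP[b /not_implyP[xb Ab]]].
move=> /existsNP[a0 /not_implyP[xa0 Ba0]].
have /choice[f fP] i : exists g : 'cV[R]_(1 + n.+1),
    [/\ g != 0, (homog b *m g) 0 0 = 0 &
    forall y, conv_hull pos (S i) y -> (homog y *m g) 0 0 = 0].
  by have [g g0 [gb gS]] := conv_hull_hyperplane pos b (S_small i); exists g.
have [e e0 aU] := ball_shrink xa0 Ba0.
have [|a /aU[xa Ba] fa] := ball_avoids_hyperplanes (f := f) a0 e0.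
  by move=> i; case: (fP i).
have Aa : A a by case: (UAB a xa).
have Bb : B b by case: (UAB b xb).
have [|t /andP[t0 t1] ABt] := closed_segment_cover cA cB Aa Bb.
  by move=> t t01; apply: UAB; exact: ball_segment.
have [i _ /= Si] := AB_small ABt; have [_ fb fS] := fP i.
have := fS _ Si; rewrite homogE.
have tE : t = 1.
  apply/eqP; rewrite -subr_eq0 -oppr_eq0 opprB.
  (* The functional is affine along the segment and vanishes at [b], so only the contribution of [a]
     remains. *)
  have /eqP : (1 - t) * (homog a *m f i) 0 0 = 0.
    rewrite -(fS _ Si) -[LHS]addr0 -(mulr0 t) -fb !homogE.
    under [X in _ = _ + X]eq_bigr do rewrite !mxE mulrDl -!mulrA.
    rewrite big_split /= -!mulr_sumr; ring.
  by rewrite mulf_eq0 (negPf (fa i)) orbF.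
move=> _; case: ABt; rewrite tE subrr scale0r add0r scale1r => ? _; exact: Ab.
Qed.

(** Finitely many hyperplanes contain the intersection, and they cannot cover a ball. *)
Lemma ball_not_within_AB x (r : R) : 0 < r -> ~ (ball x r `<=` A `&` B).
Proof.
move=> r0 sub.
have /choice[f fP] i : exists g : 'cV[R]_(1 + n.+1),
    g != 0 /\ forall y, conv_hull pos (S i) y -> (homog y *m g) 0 0 = 0.
  by have [g g0 [_ gS]] := conv_hull_hyperplane pos 0 (S_small i); exists g.
have [|a /sub/AB_small[i _ /= aS] /(_ i)/eqP fa] :=
    ball_avoids_hyperplanes (f := f) x r0.
  by move=> i; case: (fP i).
by apply: fa; case: (fP i) => _; apply.
Qed.

(** The part of [O] in the interior of [A] is relatively closed: were the ball around one of its
    limit points inside [B], it would contain a smaller ball inside both sets. By connectedness this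
    part is empty or all of [O]. *)
Lemma connected_one_side (O : set 'rV[R]_n.+1) : open O -> connected O ->
  O `<=` A `|` B -> O `<=` A \/ O `<=` B.
Proof.
move=> oO cO OAB.
have OU x : O x -> exists2 r : R, 0 < r &
    ball x r `<=` O /\ (ball x r `<=` A \/ ball x r `<=` B).
  move=> Ox; have /nbhs_ballP[r r0 rO] : nbhs x O by exact: open_nbhs_nbhs.
  by exists r => //; split=> //; apply: ball_one_side; exact: subset_trans OAB.
have [OA0|OA0] := pselect ((O `&` A°) !=set0); last first.
  right=> x Ox; have [r r0 [_ [rA|rB]]] := OU x Ox.
    by exfalso; apply: OA0; exists x; split=> //; apply/nbhs_ballP; exists r.
  by apply: rB; exact: ballxx.
left; have <- : O `&` A° = O.
  apply: cO => //; first by exists A° => //; exact: open_interior.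
  exists (closure A°); first exact: closed_closure.
  apply/seteqP; split=> x [Ox xA]; split=> //; first exact: subset_closure.
  have [r r0 [_ [rA|rB]]] := OU x Ox; first by apply/nbhs_ballP; exists r.
  have [y [/nbhs_ballP[s s0 sA] ry]] : (A° `&` ball x r) !=set0.
    by apply: xA; exact: nbhsx_ballx.
  have : nbhs y (ball x r `&` A).
    apply: filterI; last by apply/nbhs_ballP; exists s.
    by apply: open_nbhs_nbhs; split=> //; exact: ball_open.
  move=> /nbhs_ballP[e e0 eU]; exfalso; apply: (ball_not_within_AB (x := y) e0).
  by move=> z /eU[/rB ? ?].
by move=> x [_ /interior_subset].
Qed.

End Separation.

End AffineSets.

(** * Connectedness of the face graph *)

Section Mesh.
Variables (R : realType) (d' : nat) (P : fe_problem R d').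

Lemma fine_face_aggl (F : face P) (K K' : elt P) :
  fine_face_between (val F) K K' -> val F = [set agg K; agg K']%SET.
Proof.
case/and4P => KF K'F KK' _; apply/esym/eqP.
have [/eqP F2 _] := andP (valP F); rewrite eqEcard cards2 KK' F2 andbT.
by apply/fintype.subsetP => T; rewrite !inE => /orP[]/eqP->.
Qed.

Lemma face_region_sub (F : face P) (T : aggl P) :
  T \in val F -> face_region F `<=` region T.
Proof.
move=> TF x [K [K' [/fine_face_aggl FE]]].
rewrite -(mesh_conforming (meshP P)) => -[xK xK'].
by move: TF; rewrite FE !inE => /orP[]/eqP->; [exists K|exists K'].
Qed.

(** By conformity the barycenter lies in the hull of the common vertices, so every vertex of [K'] is
    common. This prevents a simplex from being hidden inside a union of others. *)
Lemma barycenter_in_simplex (K K' : elt P) :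
  conv_hull (@pos _ _ P) (vert K) (barycenter (@pos _ _ P) (vert K')) -> K = K'.
Proof.
move=> bK; have K'0 : (0 < #|vert K'|)%N by rewrite (vert_card (meshP P)).
apply/(vert_inj (meshP P))/eqP.
rewrite eq_sym eqEcard !(vert_card (meshP P)) leqnn andbT.
have /fintype.subset_trans-> // : vert K' \subset vert K :&: vert K';
  last exact: finset.subsetIl.
apply: barycenter_subface (finset.subsetIr _ _) _ => //.
  exact: (@vert_indep _ _ _ _ _ _ _ (meshP P) K').
rewrite -(mesh_conforming (meshP P)); split=> //.
by apply: conv_hull_barycenter; rewrite (vert_card (meshP P)).
Qed.

Lemma closed_union_elt (p : pred (elt P)) :
  closed (\bigcup_(K in [set K | p K]) conv_hull (@pos _ _ P) (vert K)).
Proof.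
apply: closed_bigcup; first exact: finite_finset.
move=> K _; apply: closed_simplex; first exact: (@vert_indep _ _ _ _ _ _ _ (meshP P) K).
exact: vert_card (meshP P) K.
Qed.

(** Connectedness is stated for cuts rather than paths, as it will be applied to the set of
    agglomerates whose constant is zero. *)
Lemma face_crossing (p : pred (aggl P)) (T0 T1 : aggl P) : p T0 -> ~~ p T1 ->
  exists (F : face P) T T', [/\ p T, ~~ p T', T \in val F & T' \in val F].
Proof.
move=> pT0 pT1; apply: contrapT => noF.
have [[K0 aK0] [K1 aK1]] := (agg_surj T0, agg_surj T1).
pose A := \bigcup_(K in [set K | p (agg K)]) conv_hull (@pos _ _ P) (vert K).
pose B := \bigcup_(K in [set K | ~~ p (agg K)]) conv_hull (@pos _ _ P) (vert K).
pose S (I : {u : elt P * elt P | p (agg u.1) && ~~ p (agg u.2)}) :=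
  vert (val I).1 :&: vert (val I).2.
have cA : closed A := @closed_union_elt (fun K => p (agg K)).
have cB : closed B := @closed_union_elt (fun K => ~~ p (agg K)).
have S_small I : (#|S I| <= d')%N.
  case: I => -[K K'] pKK'; rewrite /S /=; have /andP[/= pK pK'] := pKK'.
  have KK' : agg K != agg K' by apply: contraNneq pK' => <-.
  have : (#|vert K :&: vert K'| <= d'.+2)%N.
    by rewrite -(vert_card (meshP P) K) subset_leq_card // finset.subsetIl.
  rewrite leq_eqVlt => /predU1P[cKK'|].
    (* With all [d' + 2] vertices in common the two simplices coincide, yet they lie on opposite
       sides of the cut. *)
    have vKK' : vert K = vert K'.
      transitivity (vert K :&: vert K'); first apply/esym.
        by apply/eqP; rewrite eqEcard finset.subsetIl cKK' (vert_card (meshP P)) leqnn.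
      by apply/eqP; rewrite eqEcard finset.subsetIr cKK' (vert_card (meshP P)) leqnn.
    by case/eqP: KK'; rewrite (vert_inj (meshP P) vKK').
  rewrite ltnS leq_eqVlt => /predU1P[cKK'|//].
  (* With [d' + 1] common vertices they share a fine face, so their agglomerates form a face across
     the cut. *)
  have isF : is_face [set agg K; agg K']%SET.
    rewrite /is_face cards2 KK' /=; apply/existsP; exists K; apply/existsP; exists K'.
    by rewrite /fine_face_between !inE !eqxx orbT KK' cKK' eqxx.
  exfalso; apply: noF; exists (Sub _ isF), (agg K), (agg K').
  by split=> //; rewrite /= !inE eqxx ?orbT.
have AB_small : A `&` B `<=` \bigcup_I conv_hull (@pos _ _ P) (S I).
  move=> x [[K /= pK xK] [K' /= pK' xK']].
  have pKK' : p (agg (K, K').1) && ~~ p (agg (K, K').2) by rewrite pK.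
  exists (exist _ (K, K') pKK') => //=.
  by rewrite /S /= -(mesh_conforming (meshP P)).
have [oO cO O0 _ _] := Om_domain P.
have OAB : closure (Om P) `<=` A `|` B.
  rewrite -(mesh_cover (meshP P)) => x [K _ xK].
  by have [pK|pK] := boolP (p (agg K)); [left|right]; exists K.
(* The cover places barycenters in the closure of the domain, so the inclusion in one side is passed
   to closures below. *)
have inO K : closure (Om P) (barycenter (@pos _ _ P) (vert K)).
  rewrite -(mesh_cover (meshP P)); exists K => //.
  by apply: conv_hull_barycenter; rewrite (vert_card (meshP P)).
have [OA|OB] := connected_one_side cA cB S_small AB_small oO cO
    (subset_trans (@subset_closure _ _) OAB).
  have := closureS OA (inO K1); rewrite -(closure_id A).1 // => -[K /= pK].
  by move=> /barycenter_in_simplex KK1; move: pT1; rewrite -aK1 -KK1 pK.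
have := closureS OB (inO K0); rewrite -(closure_id B).1 // => -[K /= pK].
by move=> /barycenter_in_simplex KK0; move: pK; rewrite KK0 aK0 pT0.
Qed.

End Mesh.

(** * Saddle point matrices and Schur complements *)

Section Semidefinite.
Variable R : realType.

Lemma unitmx_ker0 n (M : 'M[R]_n) :
  (forall x : 'cV_n, M *m x = 0 -> x = 0) -> M \in unitmx.
Proof.
move=> Mker; rewrite -unitmx_tr -row_free_unit; apply: inj_row_free => v vM.
by apply: trmx_inj; rewrite trmx0; apply: Mker; rewrite -[M]trmxK -trmx_mul vM trmx0.
Qed.

Lemma dot_ge0 n (x : 'cV[R]_n) : 0 <= (x^T *m x) 0 0.
Proof. by rewrite mxE sumr_ge0 // => i _; rewrite mxE -expr2 sqr_ge0. Qed.

Lemma dot_eq0 n (x : 'cV[R]_n) : (x^T *m x) 0 0 = 0 -> x = 0.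
Proof.
rewrite mxE => /eqP; rewrite psumr_eq0 => [/allP x0|i _].
  apply/colP => i; have := x0 i (mem_index_enum _).
  by rewrite !mxE mulf_eq0 orbb => /eqP.
by rewrite mxE -expr2 sqr_ge0.
Qed.

(** The form is nonnegative along the line through [x] in the direction [A x]. There it equals
    [2 t b + t^2 c] with [b] the squared length of [A x], which forces [b = 0]. *)
Lemma spsd_eq0 n (A : 'M[R]_n) (x : 'cV_n) :
  spsd A -> (x^T *m A *m x) 0 0 = 0 -> A *m x = 0.
Proof.
case=> At A0 xAx; apply: dot_eq0.
pose b := ((A *m x)^T *m (A *m x)) 0 0; rewrite -/b.
pose c := ((A *m x)^T *m A *m (A *m x)) 0 0.
have b0 : 0 <= b by exact: dot_ge0.
have c0 : 0 <= c by exact: A0.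
have quadE (t : R) : ((x + t *: (A *m x))^T *m A *m (x + t *: (A *m x))) 0 0 =
    t * b *+ 2 + t ^+ 2 * c.
  have e1 : (x^T *m A *m (A *m x)) 0 0 = b by rewrite /b trmx_mul At.
  have e2 : ((A *m x)^T *m A *m x) 0 0 = b by rewrite /b mulmxA.
  have addE (M N : 'M[R]_1) : (M + N) 0 0 = M 0 0 + N 0 0 by rewrite mxE.
  have scaleE s (M : 'M[R]_1) : (s *: M) 0 0 = s * M 0 0 by rewrite mxE.
  rewrite [(_ + _)^T]linearD /= [(_ *: _)^T]linearZ /= !mulmxDl !mulmxDr.
  rewrite -!scalemxAl -!scalemxAr !(addE, scaleE) xAx e1 e2 -/c.
  ring.
have c1 : 0 < c + 1 by rewrite ltr_wpDl.
(* The denominator [c + 1] stays positive even when [c = 0]. *)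
have := A0 (x + (- b / (c + 1)) *: (A *m x)); rewrite quadE.
have -> : - b / (c + 1) * b *+ 2 + (- b / (c + 1)) ^+ 2 * c =
    - (b ^+ 2 * (c + 2) / (c + 1) ^+ 2).
  by field; rewrite gt_eqF.
rewrite oppr_ge0 pmulr_lle0 ?invr_gt0 ?exprn_gt0 // pmulr_lle0 ?ltr_wpDl //.
by move=> b2; apply/eqP; rewrite -sqrf_eq0 eq_le b2 sqr_ge0.
Qed.

Lemma spsd_congr n m (A : 'M[R]_n) (B : 'M[R]_(n, m)) :
  spsd A -> spsd (B^T *m A *m B).
Proof.
case=> At A0; split; first by rewrite !trmx_mul At trmxK mulmxA.
by move=> x; rewrite -!mulmxA mulmxA -trmx_mul mulmxA A0.
Qed.

Lemma spsd_sum (I : finType) n (A : I -> 'M[R]_n) :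
  (forall i, spsd (A i)) -> spsd (\sum_i A i).
Proof.
move=> A0; split.
  by rewrite linear_sum /=; apply: eq_bigr => i _; case: (A0 i).
move=> x; rewrite mulmx_sumr mulmx_suml summxE sumr_ge0 // => i _.
by case: (A0 i) => _; apply.
Qed.

Lemma spd_congr_eq0 n m (A : 'M[R]_n) (B : 'M[R]_(n, m)) (x : 'cV_m) :
  spd A -> B^T *m (A *m (B *m x)) = 0 -> B *m x = 0.
Proof.
case=> At A0 Bx; apply/eqP; apply/negPn/negP => /A0.
by rewrite trmx_mul -!mulmxA Bx mulmx0 mxE ltxx.
Qed.

Section SaddlePoint.
Variables (n m k : nat) (A : 'M[R]_n) (C : 'M[R]_(m, n)) (X : 'M[R]_(m, k)).
Hypothesis A_spsd : spsd A.
Let M : 'M[R]_(n + m) := block_mx A C^T C 0.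
Let Y : 'M[R]_(k, n + m) := row_mx 0 (- X^T).

Lemma saddle_energy u (l : 'cV_m) : A *m u + C^T *m l = 0 ->
  (u^T *m A *m u) 0 0 = - ((C *m u)^T *m l) 0 0.
Proof.
move=> /eqP; rewrite addr_eq0 => /eqP Au.
by rewrite -mulmxA Au mulmxN mulmxA -trmx_mul mxE.
Qed.

(** A kernel vector [(u, l)] has [C u = 0], so its energy vanishes and [A u = 0]; the two hypotheses
    then remove [u] and [l]. *)
Lemma saddle_unit :
  (forall l : 'cV_m, C^T *m l = 0 -> l = 0) ->
  (forall u : 'cV_n, A *m u = 0 -> C *m u = 0 -> u = 0) -> M \in unitmx.
Proof.
move=> Cinj ACinj; apply: unitmx_ker0 => x.
rewrite -[x]vsubmxK; move: (usubmx x) (dsubmx x) => u l.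
rewrite mul_block_col mul0mx addr0 => /eqP.
rewrite col_mx_eq0 => /andP[/eqP eA /eqP Cu].
have Au : A *m u = 0.
  by apply: spsd_eq0 => //; rewrite (saddle_energy eA) Cu trmx0 mul0mx mxE oppr0.
move: eA; rewrite Au add0r => /Cinj ->.
by rewrite (ACinj u) // col_mx0.
Qed.

Hypothesis M_unit : M \in unitmx.

Lemma schur_sym : (- (Y *m invmx M *m Y^T))^T = - (Y *m invmx M *m Y^T).
Proof.
have [At _] := A_spsd.
have Mt : M^T = M by rewrite /M tr_block_mx At trmxK trmx0.
by rewrite linearN /= !trmx_mul trmxK trmx_inv Mt mulmxA.
Qed.

(** Here [u] is the first block of the solution [(u, l)] of the saddle point system with right-hand
    side [Y^T p]. The Schur form is [(X p)^T l = - (C u)^T l], which is the energy of [u]. *)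
Lemma schur_energy (p : 'cV_k) : exists2 u, C *m u = - (X *m p) &
  (p^T *m - (Y *m invmx M *m Y^T) *m p) 0 0 = (u^T *m A *m u) 0 0.
Proof.
have YpE : Y^T *m p = col_mx 0 (- (X *m p)).
  by rewrite /Y tr_row_mx trmx0 linearN /= trmxK mul_col_mx mul0mx mulNmx.
pose x := invmx M *m (Y^T *m p).
have Mx : M *m x = col_mx 0 (- (X *m p)) by rewrite mulKVmx.
have pY : p^T *m Y = (col_mx 0 (- (X *m p)))^T by rewrite -YpE trmx_mul trmxK.
move: Mx; rewrite -[x in M *m x]vsubmxK mul_block_col mul0mx addr0.
move=> /eq_col_mx[eA Cu]; exists (usubmx x) => //.
transitivity (- (p^T *m Y *m x) 0 0).
  by rewrite mulmxN mulNmx mxE /x !mulmxA.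
rewrite pY -[x in LHS]vsubmxK tr_col_mx mul_row_col trmx0 mul0mx add0r.
by rewrite (saddle_energy eA) Cu.
Qed.

Lemma schur_spsd : spsd (- (Y *m invmx M *m Y^T)).
Proof.
split=> [|p]; first exact: schur_sym.
by have [u _ ->] := schur_energy p; case: A_spsd => _; apply.
Qed.

Hypothesis AC_ker : forall (u : 'cV_n) (p : 'cV_k),
  A *m u = 0 -> C *m u = X *m p -> u = 0 /\ p = 0.

Lemma schur_spd : spd (- (Y *m invmx M *m Y^T)).
Proof.
split=> [|p p0]; first exact: schur_sym.
have [u Cu ->] := schur_energy p; have [_ A0] := A_spsd.
rewrite lt0r A0 andbT; apply: contra_neq p0 => /(spsd_eq0 A_spsd) Au.
(* The constraint carries a minus sign, so the kernel hypothesis is applied to [- p]. *)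
have [_ /eqP] : u = 0 /\ - p = 0 by apply: AC_ker => //; rewrite mulmxN.
by rewrite oppr_eq0 => /eqP.
Qed.

(** On the kernel [C u = X p] and [X^T l = 0], so the multiplier term [(C u)^T l = p^T X^T l]
    vanishes and [u] has zero energy. *)
Lemma mortar_unit : (forall l : 'cV_m, C^T *m l = 0 -> l = 0) ->
  block_mx M (col_mx 0 (- X)) (row_mx 0 (- X^T)) 0 \in unitmx.
Proof.
move=> Cinj; apply: unitmx_ker0 => x.
rewrite -[x]vsubmxK -[usubmx x]vsubmxK.
move: (usubmx (usubmx x)) (dsubmx (usubmx x)) (dsubmx x) => u l p.
rewrite mul_block_col [M *m _]mul_block_col mul_col_mx mul_row_col !mul0mx.
rewrite addr0 add0r !mulNmx add_col_mx !addr0 => /eqP.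
rewrite !col_mx_eq0 subr_eq0 oppr_eq0 => /andP[/andP[/eqP eA /eqP Cu] /eqP Xl].
have Au : A *m u = 0.
  apply: spsd_eq0 => //; rewrite (saddle_energy eA) Cu trmx_mul -mulmxA Xl.
  by rewrite mulmx0 mxE oppr0.
have [u0 p0] := AC_ker Au Cu.
by move: eA; rewrite Au add0r => /Cinj ->; rewrite u0 p0 !col_mx0.
Qed.

End SaddlePoint.

End Semidefinite.

(** * Assembly of the mortar matrices *)

Section Subvectors.
Variables (R : realType) (I J : finType) (n : I -> nat).
Variable h : forall i, 'I_(n i) -> J.

Lemma subvE m (g : 'I_m -> J) (x : 'cV[R]_#|J|) a :
  (subv R g *m x) a 0 = x (enum_rank (g a)) 0.
Proof.
rewrite mxE (bigD1 (enum_rank (g a))) //= big1 => [|j ja].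
  by rewrite mxE enum_rankK eqxx mul1r addr0.
rewrite mxE (_ : _ == _ = false) ?mul0r //.
by apply: contra_neqF ja => /eqP <-; rewrite enum_valK.
Qed.

Lemma subv_mul_tr m m' (g : 'I_m -> J) (g' : 'I_m' -> J) :
  subv R g *m (subv R g')^T = \matrix_(a, b) (g a == g' b)%:R.
Proof.
apply/matrixP => a b.
transitivity ((subv R g *m col b (subv R g')^T) a 0).
  by rewrite !mxE; apply: eq_bigr => j _; rewrite !mxE.
by rewrite subvE !mxE enum_rankK.
Qed.

(** Joint injectivity over all [i]; tagged pairs allow indices of different types to be compared. *)
Hypothesis h_inj : forall i i' a a', h (i := i) a = h (i := i') a' ->
  Tagged (fun i => 'I_(n i)) a = Tagged (fun i => 'I_(n i)) a'.

(** The subvectors are disjoint, so restricting to one of them annihilates every other summand. *)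
Lemma subv_sum q (G : forall i, 'M[R]_(n i, q)) i :
  subv R (@h i) *m (\sum_i (subv R (@h i))^T *m G i) = G i.
Proof.
rewrite mulmx_sumr (bigD1 i) //= big1 => [|i' ii'].
  rewrite addr0 mulmxA subv_mul_tr (_ : \matrix_(a, b) _ = 1%:M) ?mul1mx //.
  apply/matrixP => a b; rewrite !mxE (_ : (h a == h b) = (a == b)) //.
  apply/eqP/eqP => [/h_inj/eqP|->//].
  by rewrite eq_Tagged => /eqP.
rewrite mulmxA subv_mul_tr (_ : \matrix_(a, b) _ = 0) ?mul0mx //.
apply/matrixP => a b; rewrite !mxE (_ : (h a == h b) = false) //.
apply: contra_neqF ii' => /eqP/h_inj/(congr1 tag) /= -> //.
Qed.

Lemma subv_eq0 (x : 'cV[R]_#|J|) : (forall j, exists i a, h (i := i) a = j) ->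
  (forall i, subv R (@h i) *m x = 0) -> x = 0.
Proof.
move=> h_surj hx; apply/colP => j; have [i [a ha]] := h_surj (enum_val j).
by rewrite -(enum_valK j) -ha -subvE hx !mxE.
Qed.

End Subvectors.

Section Assembly.
Variables (R : realType) (d' : nat) (P : fe_problem R d').
Variable W : coarse_spaces P.

(** All multipliers of one agglomerate at once, an intermediate level through which [to_mults]
    factors. *)
Definition restr_mults (T : aggl P) : 'M[R]_(#|mult W T|, #|mults W|) :=
  subv R (fun i => Tagged (mult W) (enum_val i)).

Lemma to_multsE (T : aggl P) (F : bface T) :
  to_mults W F = to_mult W F *m restr_mults T.
Proof.
apply/matrixP => a j.
transitivity ((subv R (fun i => Tagged (fun F : bface T => 'I_(mF W (val F))) i) *m
   col j (restr_mults T)) a 0); last first.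
  by rewrite !mxE; apply: eq_bigr => k _; rewrite !mxE.
by rewrite subvE !mxE enum_rankK.
Qed.

Lemma enum_val_Tagged_inj (I : finType) (T_ : I -> finType) i i'
    (a : 'I_#|T_ i|) (a' : 'I_#|T_ i'|) :
  Tagged (fun i => T_ i) (enum_val a) = Tagged (fun i => T_ i) (enum_val a') ->
  Tagged (fun i => 'I_#|T_ i|) a = Tagged (fun i => 'I_#|T_ i|) a'.
Proof.
move=> e; have /= ii' := congr1 tag e; case: _ / ii' in a' e *.
by move/eqP: e; rewrite eq_Tagged => /eqP/enum_val_inj->.
Qed.

Lemma restr_Pe T : to_edofs T *m Pe W = PT W T *m to_ecoef W T.
Proof.
under [Pe W]eq_bigr do rewrite -mulmxA.
exact: (@subv_sum R _ _ _ (fun T i => Tagged (fun T => edof T) (enum_val i)))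
  (@enum_val_Tagged_inj _ _) _ _ T.
Qed.

Lemma restr_Pb F : to_bdofs F *m Pb W = PF W F *m to_bcoef W F.
Proof.
under [Pb W]eq_bigr do rewrite -mulmxA.
exact: (@subv_sum R _ _ _ (fun F i => Tagged (fun F => bdof F) (enum_val i)))
  (@enum_val_Tagged_inj _ _) _ _ F.
Qed.

Lemma AeeE : Aee W = \sum_T (to_ecoef W T)^T *m (Aee_loc W T *m to_ecoef W T).
Proof.
by apply: eq_bigr => T _; rewrite restr_Pe trmx_mul /Aee_loc !mulmxA.
Qed.

Lemma CmxE : Cmx W = \sum_T (restr_mults T)^T *m (C_loc W T *m to_ecoef W T).
Proof.
apply: eq_bigr => T _; rewrite mulmx_suml mulmx_sumr; apply: eq_bigr => F _.
by rewrite restr_Pe to_multsE !trmx_mul !mulmxA.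
Qed.

(** The diagonal block of the local matrix [X_T] belonging to [F]. *)
Definition face_mass (F : face P) : 'M[R]_(mF W F) :=
  (PF W F)^T *m Dmx F *m PF W F.

Lemma XmxE : Xmx W = \sum_T (restr_mults T)^T *m
  \sum_(F : bface T) (to_mult W F)^T *m (face_mass (val F) *m to_bcoef W (val F)).
Proof.
apply: eq_bigr => T _; rewrite mulmx_sumr; apply: eq_bigr => F _.
by rewrite restr_Pb to_multsE !trmx_mul !mulmxA.
Qed.

(** Together with [restr_C] and [restr_trC] this expresses the block diagonality of [frakA]:
    restriction intertwines the global blocks with the local ones. *)
Lemma restr_Aee T : to_ecoef W T *m Aee W = Aee_loc W T *m to_ecoef W T.
Proof. by rewrite AeeE; apply: subv_sum. Qed.

Lemma restr_C T : restr_mults T *m Cmx W = C_loc W T *m to_ecoef W T.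
Proof. by rewrite CmxE; apply: subv_sum; exact: enum_val_Tagged_inj. Qed.

Lemma restr_trC T : to_ecoef W T *m (Cmx W)^T = (C_loc W T)^T *m restr_mults T.
Proof.
rewrite CmxE linear_sum /=.
under eq_bigr do rewrite !trmx_mul trmxK -mulmxA.
by apply: subv_sum.
Qed.

Lemma restr_C_face T (F : bface T) : to_mult W F *m C_loc W T =
  (PF W (val F))^T *m (Dmx (val F) *m (face_trace T (val F) *m PT W T)).
Proof.
rewrite /C_loc.
under eq_bigr do rewrite trmx_mul -!mulmxA.
by apply: (@subv_sum R _ _ _
  (fun F i => Tagged (fun F : bface T => 'I_(mF W (val F))) i)).
Qed.

Lemma restr_X_face T (F : bface T) : to_mult W F *m (restr_mults T *m Xmx W) =
  face_mass (val F) *m to_bcoef W (val F).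
Proof.
rewrite XmxE subv_sum; last exact: enum_val_Tagged_inj.
by apply: (@subv_sum R _ _ _
  (fun F i => Tagged (fun F : bface T => 'I_(mF W (val F))) i)).
Qed.

Lemma ecoef_eq0 (u : 'cV[R]_#|ecoef W|) : (forall T, to_ecoef W T *m u = 0) -> u = 0.
Proof. by apply: subv_eq0 => -[T i]; exists T, i. Qed.

Lemma bcoef_eq0 (p : 'cV[R]_#|bcoef W|) : (forall F, to_bcoef W F *m p = 0) -> p = 0.
Proof. by apply: subv_eq0 => -[F i]; exists F, i. Qed.

Lemma mults_eq0 (l : 'cV[R]_#|mults W|) : (forall T, restr_mults T *m l = 0) -> l = 0.
Proof.
apply: (@subv_eq0 R _ _ _ (fun T i => Tagged (mult W) (enum_val i))) => -[T i].
by exists T, (enum_rank i); rewrite enum_rankK.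
Qed.

End Assembly.

(** * The kernel of the mortar system *)

Lemma row_free_tr_inj (R : realType) n m (A : 'M[R]_(n, m)) (x : 'cV_m) :
  row_free A^T -> A *m x = 0 -> x = 0.
Proof.
move=> Af Ax; apply: trmx_inj; apply: (row_free_inj Af).
by rewrite -trmx_mul Ax !trmx0 mul0mx.
Qed.

Lemma to_ecoefK (R : realType) (d' : nat) (P : fe_problem R d')
  (W : coarse_spaces P) T : to_ecoef W T *m (to_ecoef W T)^T = 1%:M.
Proof.
rewrite subv_mul_tr; apply/matrixP => a b; rewrite !mxE.
by rewrite eq_Tagged.
Qed.

Section MortarKernel.
Variables (R : realType) (d' : nat) (P : fe_problem R d').
Variable W : coarse_spaces P.

(** Since [F] lies in the region of [T], each bdof of [F] matches exactly one edof of [T]. *)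
Lemma face_trace_const (T : aggl P) (F : face P) (c : R) : T \in val F ->
  face_trace T F *m (const_mx c : 'cV_#|edof T|) = const_mx c.
Proof.
move=> TF; apply/colP => i; rewrite !mxE; set b := enum_val i.
have bT : `[< region T (node (val b)) >].
  by apply/asboolP/(face_region_sub TF)/asboolP/(valP b).
pose e : edof T := Sub (val b) bT.
rewrite (bigD1 (enum_rank e)) //= big1 => [|j je].
  by rewrite !mxE enum_rankK eqxx mul1r addr0.
rewrite !mxE (_ : _ == _ = false) ?mul0r //.
apply: contra_neqF je => /eqP be; rewrite -(enum_valK j); congr enum_rank.
by apply: val_inj; rewrite /= -be.
Qed.

(** Diagonal entries of the stiffness matrix are energies of coordinate vectors, hence positive. *)
Lemma Dmx_spd (F : face P) : spd (stiff P) -> spd (Dmx F).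
Proof.
case=> _ stiff_gt0.
pose s (b : bdof F) := stiff P (enum_rank (val b)) (enum_rank (val b)).
have s_gt0 b : 0 < s b.
  pose e : 'cV[R]_#|dof P| := delta_mx (enum_rank (val b)) 0.
  have -> : s b = (e^T *m stiff P *m e) 0 0.
    by rewrite trmx_delta -rowE -colE [RHS]mxE [RHS]mxE.
  apply: stiff_gt0; apply/matrix0Pn; exists (enum_rank (val b)), 0.
  by rewrite mxE !eqxx oner_eq0.
have DE : Dmx F = diag_mx (\row_i s (enum_val i)).
  apply/matrixP => i j; rewrite [LHS]mxE [RHS]mxE (inj_eq enum_val_inj).
  by congr (_ *+ _); rewrite [RHS]mxE.
rewrite DE; split; first exact: tr_diag_mx.
move=> x x0; rewrite -mulmxA mul_diag_mx mxE.
have [i xi] : exists i, x i 0 != 0.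
  by move/matrix0Pn: x0 => [i [j]]; rewrite ord1; exists i.
rewrite (bigD1 i) //= ltr_pwDl //.
  by rewrite !mxE mulrCA -expr2 mulr_gt0 // exprn_even_gt0.
apply: sumr_ge0 => j _.
by rewrite !mxE mulrCA -expr2 mulr_ge0 ?sqr_ge0 // ltW.
Qed.

Hypothesis stiff_spd : spd (stiff P).
Hypothesis stiff_loc_spsd : forall T : aggl P, spsd (stiff_loc T).
Hypothesis stiff_loc_ker : forall T : aggl P,
  stiff_loc T \in unitmx \/
  (kermx (stiff_loc T) :=: (const_mx 1 : 'rV[R]_#|edof T|))%MS.
Hypothesis stiff_loc_unit : exists T : aggl P, stiff_loc T \in unitmx.
Hypothesis face_constants : forall F : face P, contains_constants W F.
Hypothesis face_proper : forall F : face P, proper_in_trace_space W F.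

(** With no bdofs the trace space would be zero and have no proper subspace. A bdof is what allows
    the constants on the two sides of [F] to be compared. *)
Lemma bdof_inhabited (F : face P) : exists b : bdof F, True.
Proof.
have [//|no] := pselect (exists b : bdof F, True).
have F0 : #|bdof F| = 0%N by apply: eq_card0 => b; case: no; exists b.
have := face_proper F; rewrite /proper_in_trace_space ltmxErank => /andP[_].
by move=> /leq_trans/(_ (rank_leq_col _)); rewrite ltnNge [X in (X <= _)%N]F0.
Qed.

Lemma local_kernel (T : aggl P) (v : 'cV[R]_#|edof T|) : stiff_loc T *m v = 0 ->
  exists c : R, v = const_mx c /\ (stiff_loc T \in unitmx -> c = 0).
Proof.
move=> Av; have [At _] := stiff_loc_spsd T.
have [u|u] := boolP (stiff_loc T \in unitmx).
  by exists 0; split=> //; rewrite -[v](mulKmx u) Av mulmx0 raddf0.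
have [/idP|kerE] := stiff_loc_ker T; first by rewrite (negPf u).
have : (v^T <= kermx (stiff_loc T))%MS.
  by apply/sub_kermxP; rewrite -{1}At -trmx_mul Av trmx0.
rewrite kerE => /sub_rVP[c vc]; exists c; split=> //.
apply: trmx_inj; rewrite vc.
by apply/rowP => i; rewrite !mxE mulr1.
Qed.

Lemma mortar_kernel (u : 'cV[R]_#|ecoef W|) (p : 'cV[R]_#|bcoef W|) :
  Aee W *m u = 0 -> Cmx W *m u = Xmx W *m p -> u = 0 /\ p = 0.
Proof.
move=> Au Cu.
have /choice[c cE] T : exists c : R, PT W T *m (to_ecoef W T *m u) = const_mx c /\
    (stiff_loc T \in unitmx -> c = 0).
  (* The equation only gives [P_T^T A_T P_T u_T = 0]; zero energy upgrades this to
     [A_T P_T u_T = 0]. *)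
  apply: local_kernel; apply: spsd_eq0 => //.
  rewrite trmx_mul -!mulmxA.
  have := congr1 (mulmx (to_ecoef W T)) Au.
  rewrite mulmxA restr_Aee mulmx0 /Aee_loc -!mulmxA => ->.
  by rewrite mulmx0 mxE.
have faceE (F : face P) T : T \in val F ->
    PF W F *m (to_bcoef W F *m p) = const_mx (c T).
  move=> TF; pose F' : bface T := Sub F TF.
  have [e eE] : exists e : 'cV_(mF W F), PF W F *m e = const_mx 1.
    have /submxP[e eE] := face_constants F; exists e^T.
    by rewrite -[PF W F]trmxK -trmx_mul -eE; apply/colP => i; rewrite !mxE.
  have ceE : PF W F *m (c T *: e) = const_mx (c T).
    by rewrite -scalemxAr eE; apply/colP => i; rewrite !mxE mulr1.
  (* The constant is in the range of [PF W F], so the difference of the two sides is too. The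
     constraint makes this difference orthogonal to that range for the positive form [Dmx F], hence
     zero. *)
  apply/esym/eqP; rewrite -subr_eq0 -ceE -mulmxBr; apply/eqP.
  apply: spd_congr_eq0; first exact: Dmx_spd F stiff_spd.
  rewrite !mulmxBr ceE; apply/eqP; rewrite subr_eq0; apply/eqP.
  have := congr1 (mulmx (to_mult W F')) (congr1 (mulmx (restr_mults W T)) Cu).
  rewrite !(mulmxA (restr_mults W T)) restr_C (mulmxA (to_mult W F') _ p).
  rewrite restr_X_face -(mulmxA (C_loc W T)) (mulmxA (to_mult W F')).
  by rewrite restr_C_face -!mulmxA (cE T).1 face_trace_const //.
have c0 T : c T = 0.
  have [T0 uT0] := stiff_loc_unit.
  apply/eqP/negPn/negP => cT.
  (* The cut separates the agglomerates with zero constant, among them the nonsingular [T0], from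
     the others. *)
  have [|F [T1 [T2 [/eqP cT1 cT2 TF1 TF2]]]] :=
      @face_crossing _ _ P (fun T => c T == 0) T0 T _ cT.
    by rewrite (cE T0).2.
  have [b _] := bdof_inhabited F; move: cT2; rewrite -cT1.
  have /colP/(_ (enum_rank b)) := etrans (esym (faceE F T1 TF1)) (faceE F T2 TF2).
  by rewrite !mxE => ->; rewrite eqxx.
split.
  apply: ecoef_eq0 => T; apply: row_free_tr_inj (PT_free W T) _.
  by rewrite (cE T).1 c0 raddf0.
apply: bcoef_eq0 => F; apply: row_free_tr_inj (PF_free W F) _.
have [T TF] : exists T, T \in val F.
  by apply/card_gt0P; have /andP[/eqP-> _] := valP F.
by rewrite (faceE F T TF) c0 raddf0.
Qed.

Lemma Aee_loc_spsd T : spsd (Aee_loc W T).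
Proof. exact: spsd_congr. Qed.

Lemma Aee_spsd : spsd (Aee W).
Proof. by apply: spsd_sum => T; exact: spsd_congr. Qed.

Hypothesis not_over_constrained : forall T : aggl P,
  \rank (C_loc W T)^T = #|mult W T|.

Lemma C_loc_tr_inj T (l : 'cV_#|mult W T|) : (C_loc W T)^T *m l = 0 -> l = 0.
Proof.
apply: row_free_tr_inj; rewrite trmxK /row_free -mxrank_tr.
by rewrite not_over_constrained.
Qed.

Lemma Cmx_tr_inj (l : 'cV_#|mults W|) : (Cmx W)^T *m l = 0 -> l = 0.
Proof.
move=> Cl; apply: mults_eq0 => T; apply: C_loc_tr_inj.
by rewrite mulmxA -restr_trC -mulmxA Cl mulmx0.
Qed.

(** A local vector with [A u = 0] and [C u = 0], extended by zero to the other agglomerates,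
    satisfies the global equations with [p = 0]. *)
Lemma frakA_loc_unit T : frakA_loc W T \in unitmx.
Proof.
apply: saddle_unit => [||u Au Cu]; [exact: Aee_loc_spsd|exact: C_loc_tr_inj|].
have [Aee_sym _] := Aee_spsd; have [Aee_loc_sym _] := Aee_loc_spsd T.
have [||u0 _] := @mortar_kernel ((to_ecoef W T)^T *m u) 0.
- rewrite mulmxA -Aee_sym -trmx_mul restr_Aee trmx_mul Aee_loc_sym.
  by rewrite -mulmxA Au mulmx0.
- rewrite mulmxA -[Cmx W]trmxK -trmx_mul restr_trC trmx_mul trmxK.
  by rewrite -mulmxA Cu !mulmx0.
by rewrite -[u]mul1mx -(to_ecoefK W T) -mulmxA u0 mulmx0.
Qed.

Lemma frakA_unit : frakA W \in unitmx.
Proof.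
apply: saddle_unit => [||u Au Cu]; [exact: Aee_spsd|exact: Cmx_tr_inj|].
by have [] := @mortar_kernel u 0 Au; rewrite ?mulmx0.
Qed.

End MortarKernel.

Theorem corollary3p4 (R : realType) (d' : nat) (P : fe_problem R d')
  (W : coarse_spaces P)
  (stiff_spd : spd (stiff P))
  (stiff_loc_spsd : forall T : aggl P, spsd (stiff_loc T))
  (stiff_loc_ker : forall T : aggl P,
     stiff_loc T \in unitmx \/
     (kermx (stiff_loc T) :=: (const_mx 1 : 'rV[R]_#|edof T|))%MS)
  (stiff_loc_unit : exists T : aggl P, stiff_loc T \in unitmx)
  (face_constants : forall F : face P, contains_constants W F)
  (face_proper : forall F : face P, proper_in_trace_space W F)
  (not_over_constrained : forall T : aggl P,
     \rank (C_loc W T)^T = #|mult W T|) :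
  (forall T : aggl P, spsd (Sigma_loc W T)) /\
  spd (Sigma W) /\
  calA W \in unitmx.
Proof.
have Aee0 := Aee_spsd W stiff_loc_spsd.
have Cinj := Cmx_tr_inj not_over_constrained.
have ker := mortar_kernel stiff_spd stiff_loc_spsd stiff_loc_ker stiff_loc_unit
  face_constants face_proper.
have unitA : frakA W \in unitmx by exact: frakA_unit.
split=> [T|].
  by apply: schur_spsd; [exact: Aee_loc_spsd|exact: frakA_loc_unit].
split; first exact: schur_spd.
exact: mortar_unit.
Qed.
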